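(* (i) For all $m,n,p,q>0$: $(n\otimes\mathcal{T}_m,=)\models\psi^q_p$ if and only if either $p+1<m$, or $p+1=m$ and $q\le n$. (ii) For all $m,n,p,q>0$: $(n\otimes\mathcal{T}_m,=)\models\rho^q_p$ if and only if $p+1=m$ and $n=q$. (iii) For all $m,p,q>0$: $(\omega\otimes\mathcal{T}_m,=)\models\psi^q_p$ if and only if $p<m$.
   Context: Intuitionistic mathematics (constructive reading of logical constants; Markov's Principle not assumed), with Brouwer's Continuity Principle as an axiom (for every $R\subseteq\mathcal{N}\times\omega$, if $\forall\alpha\exists n[\alpha Rn]$ then $\forall\alpha\exists m\exists n\forall\beta[\overline{\alpha}m\sqsubset\beta\rightarrow\beta Rn]$). $\mathcal{N}=\omega^\omega$; $\langle i\rangle\ast\delta$ is the sequence with first value $i$ followed by $\delta$. $\mathcal{T}_m:=\{\alpha\mid\forall i[\alpha(i)\le\alpha(i+1)<m]\}$. For a set $\mathcal{F}\subseteq\mathcal{N}$ and $n\in\omega$: $n\otimes\mathcal{F}:=\{\langle i\rangle\ast\delta\mid i<n,\delta\in\mathcal{F}\}$ and $\omega\otimes\mathcal{F}:=\{\langle i\rangle\ast\delta\mid i\in\omega,\delta\in\mathcal{F}\}$. Formulas (language with only $=$): $D_0(\mathsf{x}):=\forall\mathsf{y}[\mathsf{x}=\mathsf{y}\vee\neg(\mathsf{x}=\mathsf{y})]$; for $m>0$, $D_m(\mathsf{x}):=\bigwedge_{i<m}\neg D_i(\mathsf{x})\wedge\forall\mathsf{y}[\bigwedge_{i<m}\neg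 D_i(\mathsf{y})\rightarrow(\mathsf{x}=\mathsf{y}\vee\neg(\mathsf{x}=\mathsf{y}))]$; $AP(\mathsf{x},\mathsf{y}):=\forall\mathsf{z}[\neg(\mathsf{z}=\mathsf{x})\vee\neg(\mathsf{z}=\mathsf{y})]$. For $p,q>0$: $\psi^q_p:=\exists\mathsf{x}_0\dots\exists\mathsf{x}_{q-1}[\bigwedge_{i<j<q}AP(\mathsf{x}_i,\mathsf{x}_j)\wedge\bigwedge_{i<q}\bigwedge_{j<p}\neg D_j(\mathsf{x}_i)]$ and $\rho^q_p:=\exists\mathsf{x}_0\dots\exists\mathsf{x}_{q-1}[\bigwedge_{i<j<q}AP(\mathsf{x}_i,\mathsf{x}_j)\wedge\bigwedge_{i<q}\bigwedge_{j<p}\neg D_j(\mathsf{x}_i)\wedge\forall\mathsf{z}[\bigwedge_{j<p}\neg D_j(\mathsf{z})\rightarrow\bigvee_{i<q}\mathsf{z}=\mathsf{x}_i]]$. Satisfaction is read intuitionistically with $=$ interpreted as equality of sequences. *)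

(* Defs.v *)
From Stdlib Require Import Arith.

Definition Baire := nat -> nat.

Definition eqN (a b : Baire) : Prop := forall i, a i = b i.

Definition consN (i : nat) (d : Baire) : Baire :=
  fun k => match k with 0 => i | S k' => d k' end.

(* Brouwer's Continuity Principle (taken as a hypothesis of the theorem). *)
Definition BrouwerCP : Prop :=
  forall R : Baire -> nat -> Prop,
    (forall a, exists n, R a n) ->
    forall a, exists m n, forall b, (forall i, i < m -> b i = a i) -> R b n.

Definition Tm (m : nat) (a : Baire) : Prop :=
  forall i, a i <= a (S i) /\ a (S i) < m.

Definition otimes (n : nat) (F : Baire -> Prop) (a : Baire) : Prop :=
  exists i d, i < n /\ F d /\ eqN a (consN i d).

Definition otimesw (F : Baire -> Prop) (a : Baire) : Prop :=
  exists i d, F d /\ eqN a (consN i d).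

Section Formulas.
(* The domain of the structure (X, =), as a predicate on Baire space;
   all quantifiers of the formulas range over D. *)
Variable D : Baire -> Prop.

Definition decEq (x y : Baire) : Prop := eqN x y \/ ~ eqN x y.

(* notDs m x  ==  /\_{i<m} ~ D_i(x) *)
Fixpoint notDs (m : nat) (x : Baire) : Prop :=
  match m with
  | 0 => True
  | S m' => notDs m' x /\
            ~ (notDs m' x /\ forall y, D y -> notDs m' y -> decEq x y)
  end.

(* D_m(x); for m = 0 this is  forall y, x = y \/ ~ x = y  (up to True /\ _). *)
Definition Dform (m : nat) (x : Baire) : Prop :=
  notDs m x /\ forall y, D y -> notDs m y -> decEq x y.

Definition AP (x y : Baire) : Prop :=
  forall z, D z -> ~ eqN z x \/ ~ eqN z y.

Definition psi (q p : nat) : Prop :=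
  exists x : nat -> Baire,
    (forall i, i < q -> D (x i)) /\
    (forall i j, i < j -> j < q -> AP (x i) (x j)) /\
    (forall i, i < q -> notDs p (x i)).

Definition rho (q p : nat) : Prop :=
  exists x : nat -> Baire,
    (forall i, i < q -> D (x i)) /\
    (forall i j, i < j -> j < q -> AP (x i) (x j)) /\
    (forall i, i < q -> notDs p (x i)) /\
    (forall z, D z -> notDs p z -> exists i, i < q /\ eqN z (x i)).
End Formulas.

Lemma notDs_S D m x : notDs D (S m) x = (notDs D m x /\ ~ Dform D m x).
Proof. reflexivity. Qed.

(* Main.v *)
Require Import Defs.
From Stdlib Require Import Arith Lia List.

(** For a set [D] of sequences [<i> * d] whose tails [d] range over all of [T_m], the formula
    [/\_{i<j} ~ D_i] holds of [x] exactly when the tail of [x] stays below [m - j].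
    From [j] to [j + 1]: a point whose tail reaches the ceiling [m - 1 - j] is eventually
    constant there, so equality with it is decided by a finite prefix and it satisfies [D_j].
    A point [x] whose tail stays strictly below the ceiling is fixed by the continuous map
    [a |-> <x 0> * min (running max of the tail of a) ceiling] into layer [j]; if equality with
    [x] were decidable on layer [j], Brouwer's principle would make this map equal to [x] on a
    neighbourhood of [x], which a sequence jumping to the ceiling after a long prefix of [x]
    refutes. The formulas then reduce to counting: in the top layer [m = p + 1] only the points
    [<i> * 0^w] remain, one for each head [i], while below it the points [<0> * 0^k 1^w] are
    pairwise apart. *)

Definition tail (x : Baire) : Baire := fun k => x (S k).

Definition tail_below (m j : nat) (x : Baire) : Prop := forall k, x (S k) + j < m.

Record Tm_fibred (m : nat) (D : Baire -> Prop) : Prop := {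
  Tm_tail : forall x, D x -> Tm m (tail x);
  cons_Tm_mem : forall x d, D x -> Tm m d -> D (consN (x 0) d) }.

Lemma Tm_monotone m d : Tm m d -> forall i j, i <= j -> d i <= d j.
Proof. intros Hd i j Hij; induction Hij as [|j _ IH]; [lia|]. specialize (Hd j); lia. Qed.

Lemma Tm_lt m d : Tm m d -> forall i, d i < m.
Proof. intros Hd [|i]; [specialize (Hd 0)|specialize (Hd i)]; lia. Qed.

Fixpoint running_max (a : Baire) (k : nat) : nat :=
  match k with 0 => a 0 | S k => Nat.max (running_max a k) (a (S k)) end.

Definition capped_max (c : nat) (a : Baire) : Baire := fun k => Nat.min (running_max a k) c.

Lemma running_max_ge a k : a k <= running_max a k.
Proof. destruct k; simpl; lia. Qed.

Lemma running_max_Tm m a : Tm m a -> forall k, running_max a k = a k.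
Proof. intros Ha k; induction k as [|k IH]; simpl; [reflexivity|]. specialize (Ha k); lia. Qed.

Lemma Tm_capped_max m c a : c < m -> Tm m (capped_max c a).
Proof. intros Hc k; unfold capped_max; simpl; lia. Qed.

Lemma decidable_open (BCP : BrouwerCP) (P : Baire -> Prop) :
  (forall a, P a \/ ~ P a) ->
  forall a, P a -> exists M, forall b, (forall i, i < M -> b i = a i) -> P b.
Proof.
  intros Pdec a Pa.
  assert (Htot : forall b, exists n, (n = 0 /\ P b) \/ (n = 1 /\ ~ P b)).
  { intros b; destruct (Pdec b); [exists 0|exists 1]; auto. }
  destruct (BCP _ Htot a) as [M [n Hn]].
  exists M; intros b Hb.
  destruct (Hn a (fun _ _ => eq_refl)) as [[-> _]|[_ nPa]]; [|contradiction].
  destruct (Hn b Hb) as [[_ Pb]|[Hn1 _]]; [exact Pb|discriminate].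
Qed.

Lemma agree_below_dec (f g : Baire) N :
  (forall l, l < N -> f l = g l) \/ ~ (forall l, l < N -> f l = g l).
Proof.
  destruct (list_eq_dec Nat.eq_dec (map f (seq 0 N)) (map g (seq 0 N))) as [E|E];
    rewrite map_ext_in_iff in E; [left|right].
  - intros l Hl; apply E, in_seq; lia.
  - intros H; apply E; intros l Hl; apply in_seq in Hl; apply H; lia.
Qed.

Section Layers.
Variables (D : Baire -> Prop) (m : nat).
Hypothesis HD : Tm_fibred m D.

Lemma tail_monotone x : D x -> forall i j, i <= j -> x (S i) <= x (S j).
Proof. intros Dx; exact (Tm_monotone _ _ (Tm_tail _ _ HD x Dx)). Qed.

Lemma tail_below_0 x : D x -> tail_below m 0 x.
Proof. intros Dx k; rewrite Nat.add_0_r; exact (Tm_lt _ _ (Tm_tail _ _ HD x Dx) k). Qed.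

Lemma decEq_at_ceiling j k x y :
  D x -> D y -> tail_below m j x -> tail_below m j y -> m <= x (S k) + S j -> decEq x y.
Proof.
  intros Dx Dy Bx By Hk.
  destruct (agree_below_dec x y (S (S k))) as [E|NE]; [left|right].
  - intros l; destruct (Nat.lt_ge_cases l (S (S k))) as [Hl|Hl]; [auto|].
    destruct l as [|l]; [lia|].
    pose proof (tail_monotone x Dx k l ltac:(lia)).
    pose proof (tail_monotone y Dy k l ltac:(lia)).
    pose proof (Bx l); pose proof (By l); pose proof (E (S k) ltac:(lia)); lia.
  - intros Exy; apply NE; intros l _; apply Exy.
Qed.

Hypothesis BCP : BrouwerCP.

Lemma not_decEq_below_ceiling j x :
  (forall y, D y -> tail_below m j y -> notDs D j y) ->
  D x -> tail_below m (S j) x -> ~ (forall y, D y -> notDs D j y -> decEq x y).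
Proof.
  intros Hj Dx Bx Hdec.
  set (c := m - 1 - j).
  set (F := fun a => consN (x 0) (capped_max c (tail a))).
  assert (DF : forall a, D (F a)).
  { intros a; apply (cons_Tm_mem _ _ HD _ _ Dx), Tm_capped_max.
    specialize (Bx 0); unfold c; lia. }
  assert (NF : forall a, notDs D j (F a)).
  { intros a; apply Hj; [apply DF|]. intros k; cbn; unfold capped_max, c.
    specialize (Bx 0); lia. }
  assert (Fx : eqN x (F x)).
  { intros [|k]; [reflexivity|]. cbn; unfold capped_max.
    rewrite (running_max_Tm m (tail x)) by exact (Tm_tail _ _ HD x Dx).
    specialize (Bx k); unfold tail, c; lia. }
  destruct (decidable_open BCP (fun a => eqN x (F a))) with (a := x)
    as [M HM]; [intros a; exact (Hdec _ (DF a) (NF a))|exact Fx|].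
  set (b := fun l => if l <? M then x l else c).
  assert (Eb : eqN x (F b)).
  { apply HM; intros i Hi; unfold b; rewrite (proj2 (Nat.ltb_lt _ _) Hi); reflexivity. }
  specialize (Eb (S M)); cbn in Eb; unfold capped_max in Eb.
  assert (Hbc : tail b M = c).
  { unfold tail, b; rewrite (proj2 (Nat.ltb_ge (S M) M)) by lia; reflexivity. }
  pose proof (running_max_ge (tail b) M) as Hge.
  specialize (Bx M); unfold c in *; lia.
Qed.

Lemma notDs_iff_tail_below j x : D x -> notDs D j x <-> tail_below m j x.
Proof.
  revert x; induction j as [|j IH]; intros x Dx.
  - split; [intros _; exact (tail_below_0 x Dx)|intros _; exact I].
  - rewrite notDs_S; split.
    + intros [Nx NDx] k.
      destruct (Nat.lt_ge_cases (x (S k) + S j) m) as [Hlt|Hge]; [exact Hlt|exfalso].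
      apply NDx; split; [exact Nx|]; intros y Dy Ny.
      apply (decEq_at_ceiling j k); auto; apply IH; auto.
    + intros Bx.
      assert (Nx : notDs D j x) by (apply IH; [exact Dx|intros k; specialize (Bx k); lia]).
      split; [exact Nx|intros [_ Hdec]].
      apply (not_decEq_below_ceiling j x); auto.
      intros y Dy; apply IH; exact Dy.
Qed.
End Layers.

Lemma Tm_fibred_otimes n m : Tm_fibred m (otimes n (Tm m)).
Proof.
  split.
  - intros x [i [d [_ [Hd E]]]] k; unfold tail; rewrite (E (S k)), (E (S (S k))); apply Hd.
  - intros x d [i [d' [Hi [_ E]]]] Hd; exists (x 0), d.
    split; [rewrite (E 0); exact Hi|split; [exact Hd|intros k; reflexivity]].
Qed.

Lemma Tm_fibred_otimesw m : Tm_fibred m (otimesw (Tm m)).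
Proof.
  split.
  - intros x [i [d [Hd E]]] k; unfold tail; rewrite (E (S k)), (E (S (S k))); apply Hd.
  - intros x d _ Hd; exists (x 0), d; split; [exact Hd|intros k; reflexivity].
Qed.

Lemma otimes_cons_mem n m i d : i < n -> Tm m d -> otimes n (Tm m) (consN i d).
Proof. intros Hi Hd; exists i, d; split; [exact Hi|split; [exact Hd|intros k; reflexivity]]. Qed.

Lemma otimesw_cons_mem m i d : Tm m d -> otimesw (Tm m) (consN i d).
Proof. intros Hd; exists i, d; split; [exact Hd|intros k; reflexivity]. Qed.

Lemma otimes_head_lt n m x : otimes n (Tm m) x -> x 0 < n.
Proof. intros [i [d [Hi [_ E]]]]; rewrite (E 0); exact Hi. Qed.

Definition zeros : Baire := fun _ => 0.

Definition step (i : nat) : Baire := fun k => if k <? i then 0 else 1.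

Lemma Tm_zeros m : 0 < m -> Tm m zeros.
Proof. intros Hm k; unfold zeros; lia. Qed.

Lemma Tm_step m i : 1 < m -> Tm m (step i).
Proof.
  intros Hm k; unfold step.
  destruct (Nat.ltb_spec k i), (Nat.ltb_spec (S k) i); lia.
Qed.

Lemma tail_below_cons_zeros m p i : p < m -> tail_below m p (consN i zeros).
Proof. intros Hp k; cbn; unfold zeros; lia. Qed.

Lemma tail_below_cons_step m p i j : p + 1 < m -> tail_below m p (consN i (step j)).
Proof. intros Hp k; cbn; unfold step; destruct (k <? j); lia. Qed.

Lemma top_layer_cons_zeros m p x : p + 1 = m -> tail_below m p x -> eqN x (consN (x 0) zeros).
Proof. intros Hp Bx [|k]; [reflexivity|]. specialize (Bx k); cbn; unfold zeros; lia. Qed.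

Definition separated (w : nat -> Baire) : Prop := forall i j, i < j -> exists k, w i k <> w j k.

Lemma separated_cons_zeros : separated (fun i => consN i zeros).
Proof. intros i j Hij; exists 0; cbn; lia. Qed.

Lemma separated_cons_step i0 : separated (fun i => consN i0 (step i)).
Proof.
  intros i j Hij; exists (S i); cbn; unfold step.
  rewrite Nat.ltb_irrefl, (proj2 (Nat.ltb_lt _ _) Hij); discriminate.
Qed.

Lemma separated_eqN_inj w : separated w -> forall i j, eqN (w i) (w j) -> i = j.
Proof.
  intros Hw i j E.
  destruct (lt_eq_lt_dec i j) as [[Hij|Hij]|Hij]; [exfalso| exact Hij |exfalso].
  - destruct (Hw i j Hij) as [k Hk]; exact (Hk (E k)).
  - destruct (Hw j i Hij) as [k Hk]; exact (Hk (eq_sym (E k))).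
Qed.

Lemma AP_of_neq_at D x y k : x k <> y k -> AP D x y.
Proof.
  intros Hk z _; destruct (Nat.eq_dec (z k) (x k)) as [E|E]; [right|left]; intros Ez.
  - apply Hk; rewrite <- E; apply Ez.
  - apply E, Ez.
Qed.

Lemma AP_irrefl D x y : D x -> AP D x y -> ~ eqN x y.
Proof. intros Dx Hxy E; destruct (Hxy x Dx) as [N|N]; apply N; [intros k; reflexivity|exact E]. Qed.

Lemma AP_family_inj D q (x : nat -> Baire) :
  (forall i, i < q -> D (x i)) -> (forall i j, i < j -> j < q -> AP D (x i) (x j)) ->
  forall i j, i < q -> j < q -> eqN (x i) (x j) -> i = j.
Proof.
  intros Dx Ax i j Hi Hj E.
  destruct (lt_eq_lt_dec i j) as [[Hij|Hij]|Hij]; [exfalso| exact Hij |exfalso].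
  - exact (AP_irrefl D _ _ (Dx i Hi) (Ax i j Hij Hj) E).
  - exact (AP_irrefl D _ _ (Dx j Hj) (Ax j i Hij Hi) (fun k => eq_sym (E k))).
Qed.

Lemma psi_of_separated D q p (w : nat -> Baire) :
  separated w -> (forall i, i < q -> D (w i) /\ notDs D p (w i)) -> psi D q p.
Proof.
  intros Hw Hq; exists w; repeat split; try (intros i Hi; apply Hq, Hi).
  intros i j Hij _; destruct (Hw i j Hij) as [k Hk]; exact (AP_of_neq_at D _ _ k Hk).
Qed.

Lemma finite_choice (R : nat -> nat -> Prop) N :
  (forall k, k < N -> exists i, R k i) -> exists f, forall k, k < N -> R k (f k).
Proof.
  induction N as [|N IH]; intros H; [exists (fun _ => 0); lia|].
  destruct IH as [f Hf]; [intros k Hk; apply H; lia|].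
  destruct (H N (Nat.lt_succ_diag_r N)) as [i Hi].
  exists (fun k => if k =? N then i else f k); intros k Hk.
  destruct (Nat.eqb_spec k N) as [->|]; [exact Hi|apply Hf; lia].
Qed.

Lemma injective_le N q (f : nat -> nat) :
  (forall k, k < N -> f k < q) ->
  (forall k k', k < N -> k' < N -> f k = f k' -> k = k') -> N <= q.
Proof.
  intros Hf Hinj.
  rewrite <- (length_seq N 0), <- (length_map f), <- (length_seq q 0).
  apply NoDup_incl_length.
  - apply NoDup_map_NoDup_ForallPairs; [|apply seq_NoDup].
    intros k k' Hk Hk'; apply in_seq in Hk, Hk'; apply Hinj; lia.
  - intros i Hi; apply in_map_iff in Hi as [k [<- Hk]]; apply in_seq in Hk.
    apply in_seq; specialize (Hf k); lia.
Qed.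

Lemma covered_separated_le D q p (x w : nat -> Baire) N :
  (forall z, D z -> notDs D p z -> exists i, i < q /\ eqN z (x i)) ->
  separated w -> (forall k, k < N -> D (w k) /\ notDs D p (w k)) -> N <= q.
Proof.
  intros Hcov Hw HN.
  destruct (finite_choice (fun k i => i < q /\ eqN (w k) (x i)) N) as [f Hf].
  { intros k Hk; apply Hcov; apply HN, Hk. }
  apply (injective_le N q f); [intros k Hk; apply Hf, Hk|].
  intros k k' Hk Hk' E; apply (separated_eqN_inj w Hw).
  destruct (Hf k Hk) as [_ Ek], (Hf k' Hk') as [_ Ek']; rewrite E in Ek.
  intros l; rewrite (Ek l), (Ek' l); reflexivity.
Qed.

Section Counting.
Hypothesis BCP : BrouwerCP.
Variables (n m p : nat).
Let D := otimes n (Tm m).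

Let layer x : D x -> notDs D p x <-> tail_below m p x :=
  notDs_iff_tail_below D m (Tm_fibred_otimes n m) BCP p x.

Lemma cons_zeros_layer i : i < n -> p < m -> D (consN i zeros) /\ notDs D p (consN i zeros).
Proof.
  intros Hi Hp.
  assert (Di : D (consN i zeros)) by (apply otimes_cons_mem; [exact Hi|apply Tm_zeros; lia]).
  split; [exact Di|apply layer; [exact Di|apply tail_below_cons_zeros, Hp]].
Qed.

Lemma cons_step_layer i :
  0 < n -> p + 1 < m -> D (consN 0 (step i)) /\ notDs D p (consN 0 (step i)).
Proof.
  intros Hn Hp.
  assert (Di : D (consN 0 (step i))) by (apply otimes_cons_mem; [exact Hn|apply Tm_step; lia]).
  split; [exact Di|apply layer; [exact Di|apply tail_below_cons_step, Hp]].
Qed.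

Lemma psi_otimes_iff q : 0 < n -> 0 < q ->
  psi D q p <-> p + 1 < m \/ (p + 1 = m /\ q <= n).
Proof.
  intros Hn Hq; split.
  - intros [x [Dx [Ax Nx]]].
    assert (Bx : forall k, k < q -> tail_below m p (x k)) by (intros k Hk; apply layer; auto).
    destruct (Nat.lt_ge_cases (p + 1) m) as [Hlt|Hge]; [left; exact Hlt|right].
    assert (Htop : p + 1 = m) by (specialize (Bx 0 Hq 0); lia).
    split; [exact Htop|].
    apply (injective_le q n (fun k => x k 0)).
    { intros k Hk; exact (otimes_head_lt _ _ _ (Dx k Hk)). }
    intros k k' Hk Hk' E; apply (AP_family_inj D q x Dx Ax k k' Hk Hk').
    intros [|l]; [exact E|].
    rewrite (top_layer_cons_zeros m p (x k) Htop (Bx k Hk) (S l)),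
            (top_layer_cons_zeros m p (x k') Htop (Bx k' Hk') (S l)); reflexivity.
  - intros [Hlt|[Htop Hqn]].
    + apply (psi_of_separated D q p _ (separated_cons_step 0)).
      intros i _; apply cons_step_layer; assumption.
    + apply (psi_of_separated D q p _ separated_cons_zeros).
      intros i Hi; apply cons_zeros_layer; lia.
Qed.

Lemma rho_otimes_iff q : 0 < n -> 0 < q -> rho D q p <-> p + 1 = m /\ n = q.
Proof.
  intros Hn Hq; split.
  - intros [x [Dx [Ax [Nx Hcov]]]].
    destruct (proj1 (psi_otimes_iff q Hn Hq)) as [Hlt|[Htop Hqn]]; [exists x; auto| |].
    + enough (S q <= q) by lia.
      apply (covered_separated_le D q p x _ (S q) Hcov (separated_cons_step 0)).
      intros k _; apply cons_step_layer; assumption.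
    + enough (n <= q) by lia.
      apply (covered_separated_le D q p x _ n Hcov separated_cons_zeros).
      intros k Hk; apply cons_zeros_layer; lia.
  - intros [Htop <-].
    exists (fun i => consN i zeros); split; [|split; [|split]].
    + intros i Hi; apply cons_zeros_layer; lia.
    + intros i j Hij _; apply (AP_of_neq_at D _ _ 0); cbn; lia.
    + intros i Hi; apply cons_zeros_layer; lia.
    + intros z Dz Nz; exists (z 0); split; [exact (otimes_head_lt _ _ _ Dz)|].
      apply (top_layer_cons_zeros m p z Htop), layer; assumption.
Qed.
End Counting.

Lemma psi_otimesw_iff (BCP : BrouwerCP) m p q : 0 < q -> psi (otimesw (Tm m)) q p <-> p < m.
Proof.
  intros Hq.
  pose proof (notDs_iff_tail_below _ m (Tm_fibred_otimesw m) BCP p) as layer; split.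
  - intros [x [Dx [_ Nx]]].
    specialize (proj1 (layer _ (Dx 0 Hq)) (Nx 0 Hq) 0); lia.
  - intros Hp; apply (psi_of_separated _ q p _ separated_cons_zeros).
    intros i _; assert (Di : otimesw (Tm m) (consN i zeros))
      by (apply otimesw_cons_mem, Tm_zeros; lia).
    split; [exact Di|apply layer; [exact Di|apply tail_below_cons_zeros, Hp]].
Qed.

Theorem theorem8p2 (BCP : BrouwerCP) :
  (forall m n p q, 0 < m -> 0 < n -> 0 < p -> 0 < q ->
     (psi (otimes n (Tm m)) q p <-> (p + 1 < m \/ (p + 1 = m /\ q <= n)))) /\
  (forall m n p q, 0 < m -> 0 < n -> 0 < p -> 0 < q ->
     (rho (otimes n (Tm m)) q p <-> (p + 1 = m /\ n = q))) /\
  (forall m p q, 0 < m -> 0 < p -> 0 < q ->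
     (psi (otimesw (Tm m)) q p <-> p < m)).
Proof.
  split; [|split].
  - intros m n p q _ Hn _ Hq; exact (psi_otimes_iff BCP n m p q Hn Hq).
  - intros m n p q _ Hn _ Hq; exact (rho_otimes_iff BCP n m p q Hn Hq).
  - intros m p q _ _ Hq; exact (psi_otimesw_iff BCP m p q Hq).
Qed.
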